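(* Let $F$, $P$, $F_{\rm o}$ be the subsets of $\mathrm{GL}_2(\mathbb R)$ defined in the context, depending on a parameter $\epsilon$, and let $$M:=\sup_{p\in P}\bigl|\{k\in P:\ \overline F\cdot p\cap F_{\rm o}\cdot k\neq\emptyset\}\bigr|.$$ If $0<\epsilon<\frac14$, then $M\le 33$. If $\frac14\le\epsilon<\frac12$, then $M\le 36$.
   Context: $\overline F$ is the closure of $F$ in $\mathrm{GL}_2(\mathbb R)$, and $\mathrm O_2$ is the group of real orthogonal $2\times2$ matrices. For a set $S$ of matrices and a matrix $p$, $S\cdot p=\{sp:s\in S\}$; $|\cdot|$ applied to a set denotes cardinality. $$F=\left\{s\,k\begin{pmatrix}w&wy\\0&w^{-1}\end{pmatrix}: s,w\in[1,2),\ y\in[0,1),\ k\in\mathrm O_2\right\},$$ $$F_{\rm o}=\left\{s\,k\begin{pmatrix}w&wy\\0&w^{-1}\end{pmatrix}: s,w\in(1-\epsilon,2+\epsilon),\ y\in(-\epsilon,1+\epsilon),\ k\in\mathrm O_2\right\},$$ $$P=\left\{2^{\lambda}\begin{pmatrix}2^{\kappa}&2^{-\kappa}\mu\\0&2^{-\kappa}\end{pmatrix}:\lambda,\kappa,\mu\in\mathbb Z\right\}.$$ *)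

(* Defs.v *)
From HB Require Import structures.
From mathcomp Require Import all_boot all_order all_algebra.
From mathcomp Require Import all_classical all_reals all_analysis.
Set Implicit Arguments.
Unset Strict Implicit.
Unset Printing Implicit Defensive.
Import Order.TTheory GRing.Theory Num.Theory.
Import numFieldNormedType.Exports.
Local Open Scope classical_set_scope.
Local Open Scope ring_scope.

Definition mx22 (R : realType) (a b c d : R) : 'M[R]_2 :=
  \matrix_(i, j) (if i == 0 then (if j == 0 then a else b)
                  else (if j == 0 then c else d)).

Definition GL2 (R : realType) : set 'M[R]_2 := [set A | A \in unitmx].

Definition O2 (R : realType) : set 'M[R]_2 := [set k | k^T *m k = 1%:M].

Definition siegel (R : realType) (I J : set R) : set 'M[R]_2 :=
  [set A | exists s w y k, [/\ I s, I w, J y, O2 k &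
     A = s *: (k *m mx22 w (w * y) 0 w^-1)]].

Definition F (R : realType) : set 'M[R]_2 := siegel `[1, 2[ `[0, 1[.

Definition Fo (R : realType) (eps : R) : set 'M[R]_2 :=
  siegel `](1 - eps), (2 + eps)[ `](- eps), (1 + eps)[.

(* The exponents l and k are (possibly negative) integers. *)
Definition P (R : realType) : set 'M[R]_2 :=
  [set A | exists l k m : int,
     A = (2 : R) ^ l *: mx22 (2 ^ k) (2 ^ (- k) * m%:~R) 0 (2 ^ (- k))].

(* The closure in the subspace GL_2(R) of 'M[R]_2. *)
Definition GL2_closure (R : realType) (S : set 'M[R]_2) : set 'M[R]_2 :=
  closure S `&` @GL2 R.

Definition mulset (R : realType) (S : set 'M[R]_2) (p : 'M[R]_2) : set 'M[R]_2 :=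
  [set s *m p | s in S].

(* [counting] is the number of elements, +oo on infinite sets; the supremum is
   taken in the extended reals. *)
Definition M (R : realType) (eps : R) : \bar R :=
  ereal_sup [set counting
               [set k | P k /\
                  mulset (GL2_closure (@F R)) p `&` mulset (Fo eps) k !=set0]
            | p in @P R].

(* Main.v *)
Require Import Defs.
From mathcomp Require Import all_boot all_order all_algebra.
From mathcomp Require Import all_classical all_reals all_analysis.
From mathcomp Require finmap.
From mathcomp Require Import ring lra zify.
Import Order.TTheory GRing.Theory Num.Theory.
Import numFieldNormedType.Exports.
Local Open Scope classical_set_scope.
Local Open Scope ring_scope.

(** The coordinates s, w, y of an Iwasawa decomposition can be read off three
    functions of a matrix that do not change under left multiplication by an
    orthogonal matrix: the area of the parallelogram spanned by the two columns,
    the squared length of the first column, and the dot product of the columns.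
    At s k (w, wy; 0, 1/w) they are s^2, s^2 w^2 and s^2 w^2 y, so s^2, w^2 and y
    are the area, the ratio len2 / area and the ratio dotp / len2.

    The three functions are continuous, hence the closure of F satisfies the
    weak inequalities coming from s, w in [1, 2] and y in [0, 1]
    ([closure_F_bounds]).  Right multiplication by the element of P with
    parameters l, k, m multiplies s by 2^l and w by 2^k, and turns y into
    (m + y) / 4^k ([Pmx_invariants]).  Let A in the closure of F and B in Fo
    satisfy A p = B p', where p and p' in P have parameters l, k, m and
    l', k', m'.

    - Comparing s and w: if a number in (1/2, 5/2) is a power of two times a
      number in [1, 2], that power is 1/2, 1 or 2, so l' - l and k' - k lie in
      {-1, 0, 1} ([dyadic_step]).
    - Comparing y: m' + y = 4^(k' - k) (m + t) with t in [0, 1] and y in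
      (- eps, 1 + eps), so m' lies in an open interval of length 5/4 + 2 eps,
      2 + 2 eps or 5 + 2 eps according to the value of k' - k ([mem_shears]).
      Such an interval contains at most n, 3, 6 integers respectively, where
      n = 2 if eps < 1/4 and n = 3 if eps < 1/2.

    This leaves 3 (n + 3 + 6) possibilities for p', that is 33 or 36. *)

(** * The three invariants *)

Definition area {R : realType} (A : 'M[R]_2) : R := `|\det A|.
Definition len2 {R : realType} (A : 'M[R]_2) : R := (A^T *m A) 0 0.
Definition dotp {R : realType} (A : 'M[R]_2) : R := (A^T *m A) 0 1.

Lemma sum_ord2 {R : realType} (f : 'I_2 -> R) : \sum_(i < 2) f i = f 0 + f 1.
Proof.
by rewrite !big_ord_recl big_ord0 addr0; congr (_ + f _); apply/val_inj.
Qed.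

Lemma det22 {R : realType} (A : 'M[R]_2) :
  \det A = A 0 0 * A 1 1 - A 0 1 * A 1 0.
Proof.
rewrite (expand_det_row _ 0) sum_ord2 /cofactor.
rewrite !det_mx11 !mxE /= expr0 mul1r expr1 mulN1r mulrN.
by congr (_ * fun_of_matrix A _ _ - _ * fun_of_matrix A _ _); apply/val_inj.
Qed.

Lemma len2E {R : realType} (A : 'M[R]_2) : len2 A = A 0 0 ^+ 2 + A 1 0 ^+ 2.
Proof. by rewrite /len2 mxE sum_ord2 !mxE !expr2. Qed.

Lemma dotpE {R : realType} (A : 'M[R]_2) :
  dotp A = A 0 0 * A 0 1 + A 1 0 * A 1 1.
Proof. by rewrite /dotp mxE sum_ord2 !mxE. Qed.

(** The next three lemmas serve both for the elements of P and, with A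
    orthogonal, for the triangular factor in the definition of a Siegel set. *)
Lemma area_upper {R : realType} (A : 'M[R]_2) (c u x : R) : u != 0 ->
  area (A *m (c *: mx22 u x 0 u^-1)) = c ^+ 2 * area A.
Proof.
move=> u0; rewrite /area det_mulmx normrM mulrC; congr (_ * _).
rewrite det22 !mxE /=.
have -> : c * u * (c * u^-1) - c * x * (c * 0) = c ^+ 2 by field.
by rewrite ger0_norm ?sqr_ge0.
Qed.

Lemma len2_upper {R : realType} (A : 'M[R]_2) (c u x : R) :
  len2 (A *m (c *: mx22 u x 0 u^-1)) = (c * u) ^+ 2 * len2 A.
Proof. by rewrite !len2E !mxE !sum_ord2 !mxE /=; ring. Qed.

Lemma dotp_upper {R : realType} (A : 'M[R]_2) (c u x : R) : u != 0 ->
  dotp (A *m (c *: mx22 u x 0 u^-1)) =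
  c ^+ 2 * (u * x * len2 A + dotp A).
Proof. by move=> u0; rewrite !dotpE len2E !mxE !sum_ord2 !mxE /=; field. Qed.

(** If 0 is not in I, then w is invertible and the orthogonal factor, whose
    invariants are 1, 1 and 0, drops out. *)
Lemma siegel_invariants {R : realType} {I J : set R} {A : 'M[R]_2} :
  ~ I 0 -> siegel I J A ->
  exists s w y, [/\ I s, I w, J y &
    [/\ area A = s ^+ 2, len2 A = (s * w) ^+ 2 & dotp A = (s * w) ^+ 2 * y]].
Proof.
move=> I0 [s [w [y [k [Is Iw Jy Ok ->]]]]]; exists s, w, y; split=> //.
have w0 : w != 0 by apply: contra_notN I0 => /eqP <-.
have len_k : len2 k = 1 by rewrite /len2 Ok mxE.
have dot_k : dotp k = 0 by rewrite /dotp Ok mxE.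
have area_k : area k = 1.
  apply/eqP; rewrite -sqr_norm_eq1.
  by rewrite expr2 -{1}det_tr -det_mulmx Ok det1.
rewrite scalemxAr area_upper // len2_upper dotp_upper // len_k dot_k area_k.
by split; ring.
Qed.

(** * The closure of F *)

Lemma area_continuous {R : realType} : continuous (@area R).
Proof.
move=> A; rewrite (_ : @area R = fun B => `|B 0 0 * B 1 1 - B 0 1 * B 1 0|); last first.
  by apply/funext => B; rewrite /area det22.
have c i j := @coord_continuous R 2 2 i j A.
exact: cvg_norm (cvgB (cvgM (c 0 0) (c 1 1)) (cvgM (c 0 1) (c 1 0))).
Qed.

Lemma len2_continuous {R : realType} : continuous (@len2 R).
Proof.
move=> A; rewrite (_ : @len2 R = fun B => B 0 0 * B 0 0 + B 1 0 * B 1 0); last first.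
  by apply/funext => B; rewrite len2E !expr2.
have c i j := @coord_continuous R 2 2 i j A.
exact: cvgD (cvgM (c 0 0) (c 0 0)) (cvgM (c 1 0) (c 1 0)).
Qed.

Lemma dotp_continuous {R : realType} : continuous (@dotp R).
Proof.
move=> A; rewrite (_ : @dotp R = fun B => B 0 0 * B 0 1 + B 1 0 * B 1 1); last first.
  by apply/funext => B; rewrite dotpE.
have c i j := @coord_continuous R 2 2 i j A.
exact: cvgD (cvgM (c 0 0) (c 0 1)) (cvgM (c 1 0) (c 1 1)).
Qed.

Lemma closure_ge0 {R : realType} {T : topologicalType} {S : set T} {f : T -> R} {x : T} :
  continuous f -> (forall y, S y -> 0 <= f y) -> closure S x -> 0 <= f x.
Proof.
move=> cf fS Sx.
have cl : closed (f @^-1` [set t | 0 <= t]).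
  by apply: preimage_closed => [y _|]; [exact: cf | exact: closed_ge].
by move: (closureS fS Sx); rewrite -(closure_id _).1.
Qed.

(** Each bound is the nonnegativity of an affine combination of the three
    invariants, which passes from F to its closure by continuity. *)
Lemma closure_F_bounds {R : realType} {A : 'M[R]_2} : closure (@F R) A ->
  [/\ 1 <= area A <= 4, area A <= len2 A <= 4 * area A & 0 <= dotp A <= len2 A].
Proof.
move=> FA.
have bF (B : 'M[R]_2) : F B ->
    [/\ 1 <= area B <= 4, area B <= len2 B <= 4 * area B & 0 <= dotp B <= len2 B].
  case/siegel_invariants; first by rewrite /= in_itv /= ler10.
  move=> s [w [y [/= ]]]; rewrite !in_itv /= => hs hw hy [-> -> ->].
  have s1 : 1 <= s ^+ 2 <= 4 by apply/andP; split; nra.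
  have w1 : 1 <= w ^+ 2 <= 4 by apply/andP; split; nra.
  have pq : s ^+ 2 <= s ^+ 2 * w ^+ 2 <= 4 * s ^+ 2.
    by move: s1 w1; move: (s ^+ 2) (w ^+ 2) => p q *; apply/andP; split; nra.
  rewrite exprMn; split=> //.
  by move: s1 pq; move: (_ * w ^+ 2) => q *; apply/andP; split; nra.
have := @area_continuous R; have := @len2_continuous R; have := @dotp_continuous R.
move=> cd cl ca.
have lin (a b c d : R) :
    (forall B, F B -> 0 <= a * area B + b * len2 B + c * dotp B + d) ->
    0 <= a * area A + b * len2 A + c * dotp A + d.
  move=> h; apply: (closure_ge0 _ h FA) => B.
  have scale (x : R) (f : 'M[R]_2 -> R) : continuous f ->
      (fun C => x * f C) @ B --> x * f B.
    by move=> cf; exact: cvgM (cvg_cst x) (cf B).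
  exact: cvgD (cvgD (cvgD (scale a _ ca) (scale b _ cl)) (scale c _ cd)) (cvg_cst d).
have h1 := lin 1 0 0 (-1); have h2 := lin (-1) 0 0 4.
have h3 := lin (-1) 1 0 0; have h4 := lin 4 (-1) 0 0.
have h5 := lin 0 0 1 0; have h6 := lin 0 1 (-1) 0.
split; apply/andP; split.
- suff: 0 <= 1 * area A + 0 * len2 A + 0 * dotp A + -1 by lra.
  by apply: h1 => B /bF [? ? ?]; lra.
- suff: 0 <= -1 * area A + 0 * len2 A + 0 * dotp A + 4 by lra.
  by apply: h2 => B /bF [? ? ?]; lra.
- suff: 0 <= -1 * area A + 1 * len2 A + 0 * dotp A + 0 by lra.
  by apply: h3 => B /bF [? ? ?]; lra.
- suff: 0 <= 4 * area A + -1 * len2 A + 0 * dotp A + 0 by lra.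
  by apply: h4 => B /bF [? ? ?]; lra.
- suff: 0 <= 0 * area A + 0 * len2 A + 1 * dotp A + 0 by lra.
  by apply: h5 => B /bF [? ? ?]; lra.
- suff: 0 <= 0 * area A + 1 * len2 A + -1 * dotp A + 0 by lra.
  by apply: h6 => B /bF [? ? ?]; lra.
Qed.

(** * Comparing two translates *)

Definition Pmx {R : realType} (l k m : int) : 'M[R]_2 :=
  (2 : R) ^ l *: mx22 (2 ^ k) (2 ^ (- k) * m%:~R) 0 (2 ^ (- k)).

Lemma Pmx_invariants {R : realType} (A : 'M[R]_2) (l k m : int) :
  [/\ area (A *m Pmx l k m) = (2 ^ l) ^+ 2 * area A,
      len2 (A *m Pmx l k m) = (2 ^ l) ^+ 2 * ((2 ^ k) ^+ 2 * len2 A) &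
      dotp (A *m Pmx l k m) = (2 ^ l) ^+ 2 * (m%:~R * len2 A + dotp A)].
Proof.
have u0 : (2 : R) ^ k != 0 by rewrite expfz_neq0 // pnatr_eq0.
rewrite /Pmx -!invr_expz area_upper // len2_upper dotp_upper // mulVKf //.
by split=> //; ring.
Qed.

Lemma exp2z_step {R : realType} (i j : int) : i + 2 <= j -> 4 * (2 : R) ^ i <= 2 ^ j.
Proof.
move=> ij; apply: (@le_trans _ _ ((2 : R) ^ (i + 1 + 1))).
  by rewrite !expfzDr ?pnatr_eq0 // expr1z; lra.
by rewrite ler_weXz2l ?ler1n //; lia.
Qed.

(** The squares of the scale factors: the quotient y / x lies in (1/16, 25/4),
    and the only powers of 4 there are 1/4, 1 and 4. *)
Lemma dyadic_step {R : realType} {x y : R} {m n : int} :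
  1 <= x <= 4 -> 1 / 4 < y < 25 / 4 -> (2 ^ m) ^+ 2 * x = (2 ^ n) ^+ 2 * y ->
  n \in [:: m - 1; m; m + 1].
Proof.
move=> hx hy e.
have m0 : 0 < (2 : R) ^ m by rewrite exprz_gt0 // ltr0n.
have n0 : 0 < (2 : R) ^ n by rewrite exprz_gt0 // ltr0n.
have [mn|mn] := leP (m + 2) n.
  have h : (4 * (2 : R) ^ m) ^+ 2 <= (2 ^ n) ^+ 2.
    by rewrite ler_sqr ?nnegrE ?exp2z_step //; lra.
  have : 0 < (2 ^ m) ^+ 2 :> R by rewrite exprn_gt0.
  move: h; rewrite exprMn; nra.
have [nm|nm] := leP (n + 2) m.
  have h : (4 * (2 : R) ^ n) ^+ 2 <= (2 ^ m) ^+ 2.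
    by rewrite ler_sqr ?nnegrE ?exp2z_step //; lra.
  have : 0 < (2 ^ n) ^+ 2 :> R by rewrite exprn_gt0.
  move: h; rewrite exprMn; nra.
by rewrite !inE; lia.
Qed.

(** The n consecutive integers starting with the first one above a; an open
    interval of length at most n with left end a contains no other integer. *)
Definition window {R : realType} (a : R) (n : nat) : seq int :=
  [seq Num.floor a + 1 + i%:Z | i <- iota 0 n].

Lemma mem_window {R : realType} (a : R) (n : nat) (m : int) :
  a < m%:~R < a + n%:R -> m \in window a n.
Proof.
case/andP=> am man.
have fm : Num.floor a + 1 <= m by rewrite lezD1 floor_lt_int.
have mf : m < Num.floor a + 1 + n%:Z.
  rewrite -(ltr_int R); apply: (lt_trans man).
  by rewrite rmorphD /= -pmulrn ltrD2r floorD1_gt.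
apply/mapP; exists (absz (m - (Num.floor a + 1))%R); first by rewrite mem_iota; lia.
by lia.
Qed.

(** The candidates for (k', m'), one row for each value of k' - k in
    {-1, 0, 1}; the windows start at the left ends of the intervals that
    [mem_shears] finds for m'. *)
Definition shears {R : realType} (eps : R) (n : nat) (k m : int) : seq (int * int) :=
  [seq (k - 1, m') | m' <- window (m%:~R / 4 - 1 - eps) n] ++
  [seq (k, m') | m' <- window (m%:~R - 1 - eps) 3] ++
  [seq (k + 1, m') | m' <- window (4 * m%:~R - 1 - eps) 6].

(** The equation puts m' strictly between d m - 1 - eps and d (m + 1) + eps with
    d = 1/4, 1 or 4; the lengths 5/4 + 2 eps, 2 + 2 eps and 5 + 2 eps of these
    intervals are at most n, 3 and 6. *)
Lemma mem_shears {R : realType} {eps t y : R} {n : nat} {k m k' m' : int} :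
  0 < eps < 1 / 2 -> 5 / 4 + 2 * eps <= n%:R ->
  0 <= t <= 1 -> - eps < y < 1 + eps -> k' \in [:: k - 1; k; k + 1] ->
  (2 ^ k) ^+ 2 * (m'%:~R + y) = (2 ^ k') ^+ 2 * (m%:~R + t) ->
  (k', m') \in shears eps n k m.
Proof.
move=> he hn ht hy hk shear.
have K0 : (2 ^ k) ^+ 2 != 0 :> R by rewrite !expf_neq0 // expfz_neq0 // pnatr_eq0.
rewrite /shears !mem_cat; rewrite !inE in hk.
case/or3P: hk shear => /eqP ->.
- rewrite expfzDr ?pnatr_eq0 // exprN1 => sh.
  have {}sh : m'%:~R + y = (m%:~R + t) / 4.
    by apply: (mulfI K0); rewrite sh; field.
  apply/orP; left; apply: map_f; apply: mem_window.
  by apply/andP; split; lra.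
- move=> /(mulfI K0) sh.
  apply/orP; right; apply/orP; left; apply: map_f; apply: mem_window.
  by apply/andP; split; lra.
- rewrite expfzDr ?pnatr_eq0 // expr1z => sh.
  have {}sh : m'%:~R + y = (m%:~R + t) * 4.
    by apply: (mulfI K0); rewrite sh; ring.
  apply/orP; right; apply/orP; right; apply: map_f; apply: mem_window.
  by apply/andP; split; lra.
Qed.

(** * The count *)

Definition neighbours {R : realType} (eps : R) (n : nat) (l k m : int) : seq 'M[R]_2 :=
  [seq Pmx l' x.1 x.2 | l' <- [:: l - 1; l; l + 1], x <- shears eps n k m].

Lemma size_neighbours {R : realType} (eps : R) (n : nat) (l k m : int) :
  size (neighbours eps n l k m) = (3 * (n + 9))%N.
Proof. by rewrite size_allpairs !size_cat !size_map !size_iota. Qed.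

Lemma neighboursP {R : realType} (eps : R) (n : nat) (l k m l' k' m' : int) (A B : 'M[R]_2) :
  0 < eps < 1 / 2 -> 5 / 4 + 2 * eps <= n%:R ->
  closure (@F R) A -> Fo eps B -> A *m Pmx l k m = B *m Pmx l' k' m' ->
  Pmx l' k' m' \in neighbours eps n l k m.
Proof.
move=> he hn /closure_F_bounds [hD ha hb] hB AB.
have [s [w [y [/= ]]]] : exists s w y, [/\ `](1 - eps), (2 + eps)[%classic s,
    `](1 - eps), (2 + eps)[%classic w, `](- eps), (1 + eps)[%classic y &
    [/\ area B = s ^+ 2, len2 B = (s * w) ^+ 2 & dotp B = (s * w) ^+ 2 * y]].
  by apply: (siegel_invariants _ hB); rewrite /= in_itv /=; lra.
rewrite !in_itv /= => hs hw hy [aB lB dB].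
have hs2 : 1 / 4 < s ^+ 2 < 25 / 4 by apply/andP; split; nra.
have hw2 : 1 / 4 < w ^+ 2 < 25 / 4 by apply/andP; split; nra.
have [a1 b1 c1] := Pmx_invariants A l k m.
have [a2 b2 c2] := Pmx_invariants B l' k' m'.
rewrite AB a2 aB in a1; rewrite AB b2 lB in b1; rewrite AB c2 lB dB in c1.
have posX (i : int) : 0 < (2 : R) ^ i by rewrite exprz_gt0 // ltr0n.
have l0 := posX l; have l'0 := posX l'; have k0 := posX k; have k'0 := posX k'.
have D0 : 0 < area A by lra.
have hl := dyadic_step hD hs2 (esym a1).
have L0 : (2 ^ l) ^+ 2 != 0 :> R by rewrite expf_eq0 /= gt_eqF.
have L'0 : (2 ^ l') ^+ 2 != 0 :> R by rewrite expf_eq0 /= gt_eqF.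
have s0 : s ^+ 2 != 0 by apply/lt0r_neq0; lra.
(* The quotient of the equality of squared lengths by that of areas. *)
have bk : (2 ^ k) ^+ 2 * (len2 A / area A) = (2 ^ k') ^+ 2 * w ^+ 2.
  apply: (mulfI (mulf_neq0 L'0 s0)).
  transitivity ((2 ^ l) ^+ 2 * ((2 ^ k) ^+ 2 * len2 A)); last by rewrite -b1; ring.
  by rewrite a1; field; lra.
have hr : 1 <= len2 A / area A <= 4.
  by rewrite ler_pdivlMr // ler_pdivrMr // mul1r.
have hk := dyadic_step hr hw2 bk.
have len0 : 0 < len2 A by lra.
pose t := dotp A / len2 A.
have ht : 0 <= t <= 1 by rewrite /t ler_pdivlMr // ler_pdivrMr // mul0r mul1r.
(* The quotient of the equality of dot products by that of squared lengths. *)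
have shear : (2 ^ k) ^+ 2 * (m'%:~R + y) = (2 ^ k') ^+ 2 * (m%:~R + t).
  have q0 : (2 ^ l) ^+ 2 * len2 A != 0 by rewrite mulf_neq0 // gt_eqF.
  apply: (mulfI q0).
  transitivity ((2 ^ k') ^+ 2 * ((2 ^ l) ^+ 2 * (m%:~R * len2 A + dotp A))); last first.
    by rewrite /t; field; lra.
  rewrite -c1.
  transitivity ((2 ^ l) ^+ 2 * ((2 ^ k) ^+ 2 * len2 A) * (m'%:~R + y)); first by ring.
  by rewrite -b1; ring.
apply/allpairsP; exists (l', (k', m')); split=> //.
exact: (mem_shears he hn ht hy hk shear).
Qed.

Lemma counting_le_size {R : realType} {T : choiceType} (A : set T) (s : seq T) :
  A `<=` [set` s] -> (counting A <= (size s)%:R%:E :> \bar R)%E.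
Proof.
move=> As; have fA : finite_set A := sub_finite_set As (finite_seq s).
rewrite /counting asboolT // lee_fin ler_nat; apply: uniq_leq_size.
  exact: finmap.fset_uniq.
by move=> x; rewrite in_fset_set // inE => /As.
Qed.

Lemma M_le {R : realType} (eps : R) (n : nat) :
  0 < eps < 1 / 2 -> 5 / 4 + 2 * eps <= n%:R -> (M eps <= (3 * (n + 9))%:R%:E)%E.
Proof.
move=> he hn; apply: ge_ereal_sup => _ [_ [l [k [m ->]]] <-].
rewrite -(size_neighbours eps n l k m); apply: counting_le_size.
move=> _ [[l' [k' [m' ->]]] [X [[A [FA _] AX] [B FB BX]]]].
by apply: (neighboursP _ _ _ _ _ _ _ _ _ B he hn FA FB); rewrite AX BX.
Qed.

Theorem mainTheorem5 (R : realType) (eps : R) :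
  (0 < eps < 1 / 4 -> (M eps <= 33%:E)%E) /\
  (1 / 4 <= eps < 1 / 2 -> (M eps <= 36%:E)%E).
Proof.
by split=> he; [apply: (M_le _ 2)|apply: (M_le _ 3)]; lra.
Qed.
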